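(* Let $(M,V)$ be a structure in a countable relational signature $L$. For every $v_0\in V$ there exist a compact $\omega$-structure $(N,W)$ in signature $L$ and an elementary embedding $f:W\to V$ such that $v_0\in f[W]$. In particular, $M$ and $N$ are elementarily equivalent, and for every $v_0\in V$ there is a compact $\omega$-structure realizing the type $\mathrm{tp}(v_0)$.
   Context: Relations: for $R\subseteq A\times B$, $[a]_R=\{b: aRb\}$. $R$ is surjective if every $a\in A$ has some $b$ with $aRb$, co-surjective if every $b\in B$ has some $a$ with $aRb$. $\pi_R\subseteq R$ consists of those $(a,b)\in R$ with $a$ the only element related to $b$; $R$ is co-injective if $\pi_R$ is surjective, co-bijective if co-injective and co-surjective. $R\circ S=\{(a,c):\exists b\,(aRb\wedge bSc)\}$. A context is a finite set of variables (from a fixed countable supply containing a special variable $*$). A co-valuation on $M$ in context $X$ is a co-bijective $v\subseteq X\times M$; $\mathrm{Val}(X,M)$ is the set of these. For $w\in\mathrm{Val}(Y,M)$, $\geq\in\mathrm{Val}(X,Y)$, $C_\geq(w)=\geq\circ w$; $v=C_\geq(w)$ means $v$ consolidates $w$ with pattern $\geq$ and $w$ fragments $v$. $x\geq^v_w y$ iff $[x]_v\supseteq[y]_w$. Formulas in context $X$: $\bot$; $R(x_1,\dots,x_{a(R)})$ with $x_k\in X$; $\neg\phi$, $\phi\wedge\psi$; $\exists^{\mathrm{fr}}_\geq\phi$ with $\geq\in\mathrm{Val}(X,Y)$, $\phi$ in context $Y$. Sentences are formulas in context $\{*\}$. A proto-structure $(M,\{R^M\},V)$: first-order $L$-structure with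 family $V$ of co-valuations on $M$ in contexts, closed under consolidations by contexts; $V^X=V\cap\mathrm{Val}(X,M)$. Satisfaction for $v\in V^X$: $M\not\models_v\bot$; $M\models_v R(\bar x)$ iff some $a_k\in[x_k]_v$ satisfy $R^M(\bar a)$; Boolean connectives as usual; $M\models_v\exists^{\mathrm{fr}}_\geq\phi$ iff some $w\in V$ has $v=C_\geq(w)$ and $M\models_w\phi$. A structure satisfies (I) any two members of $V$ are fragmented by a common member of $V$; (II) if $v\in V^X$ and $M\models_v R(\bar x)$ then there are $w\in V^Y$, $\bar y\in Y^{a(R)}$, $\bar a$ with $a_k\in[y_k]_{\pi_w}$, $[x_k]_v\supseteq[y_k]_w$ for all $k$, and $R^M(\bar a)$. The type $\mathrm{tp}(v)$ of $v\in V^X$ is the set of formulas $\phi(X)$ with $M\models_v\phi$; it is realized in $(N,W)$ if some $w\in W^X$ satisfies all of them. A sentence holds in a structure if it is satisfied by its (unique) admissible co-valuation in context $\{*\}$; elementarily equivalent structures satisfy the same sentences. A structure $(M,V)$ is compact if there is a compact $T_1$ topology $\tau_V$ on $M$ such that each $\{[x]_v:x\in X\}$, $v\in V^X$, is a $\tau_V$-open cover of $M$, every $\tau_V$-open cover of $M$ is refined by some such cover, and all $R^M$ are $\tau_V$-closed. It is an $\omega$-structure if there is a sequence $(v_i)$ in $V$ with each $v_i$ a consolidation of $v_{i+1}$ such that every member of $V$ is a consolidation of some $v_i$. For structures $(M,V)$, $(N,W)$, an elementary embedding is an injection $f:W\to V$ such that for $w,w'\in W$ and patterns $\geq$: $w=C_\geq(w')$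 iff $f(w)=C_\geq(f(w'))$, and for every $w\in W$ and formula $\phi$: $N\models_w\phi$ iff $M\models_{f(w)}\phi$. *)

(* Defs.v *)
From HB Require Import structures.
From mathcomp Require Import all_boot finmap.
From mathcomp Require Import boolp classical_sets functions cardinality.
From mathcomp Require Import topology.
Set Implicit Arguments.
Unset Strict Implicit.
Unset Printing Implicit Defensive.

Local Open Scope classical_set_scope.

(* A relation R between A and B is a map A -> set B, so that R a is literally
   the set [a]_R of all b with a R b. *)
Section Relations.
Variables A B C : Type.

Definition rel_surjective (R : A -> set B) : Prop :=
  forall a, exists b, R a b.

Definition rel_cosurjective (R : A -> set B) : Prop :=
  forall b, exists a, R a b.

Definition rel_pi (R : A -> set B) : A -> set B :=
  fun a => [set b | R a b /\ forall a', R a' b -> a' = a].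

Definition rel_comp (R : A -> set B) (S : B -> set C) : A -> set C :=
  fun a => [set c | exists b, R a b /\ S b c].

End Relations.

Definition rel_coinjective (A B : Type) (R : A -> set B) : Prop :=
  rel_surjective (rel_pi R).

(* Val X M: the co-valuations on M in context X when X is a context; the
   patterns between X and Y when both are contexts. *)
Definition Val (A B : Type) : set (A -> set B) :=
  [set R | rel_coinjective R /\ rel_cosurjective R].

Arguments Val : clear implicits.

(* The variables are the natural numbers, and the special variable is 0.  A
   context X is used as a type through the coercion of finite sets to types. *)
Notation context := {fset nat}.

Definition star : nat := 0.

Definition star_context : context := [fset star]%fset.

Section Consolidation.
Variables (X Y : context) (M : Type).

Definition consolidate (ge : X -> set Y) (w : Y -> set M) : X -> set M :=
  rel_comp ge w.

Definition consolidation (v : X -> set M) (w : Y -> set M) : Prop :=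
  exists2 ge : X -> set Y, Val X Y ge & v = consolidate ge w.

End Consolidation.

Record signature := Signature {
  symbol : Type;
  arity : symbol -> nat
}.

Inductive formula (L : signature) : context -> Type :=
| Bot (X : context) : formula L X
| Atom (X : context) (R : symbol L) (x : 'I_(arity R) -> X) : formula L X
| Neg (X : context) (phi : formula L X) : formula L X
| Conj (X : context) (phi psi : formula L X) : formula L X
| ExFr (X Y : context) (ge : X -> set Y) (ge_pattern : Val X Y ge)
    (phi : formula L Y) : formula L X.

Definition sentence (L : signature) : Type := formula L star_context.

(* A surjective relation determines its domain, so a family of co-valuations
   splits without loss into its parts V^X; admissible X is V^X. *)
Record protoStructure (L : signature) := ProtoStructure {
  carrier :> Type;
  interp : forall R : symbol L, set ('I_(arity R) -> carrier);
  admissible : forall X : context, set (X -> set carrier);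
  admissible_Val : forall X : context, @admissible X `<=` Val X carrier;
  admissible_consolidate :
    forall (X Y : context) (ge : X -> set Y) (w : Y -> set carrier),
      Val X Y ge -> @admissible Y w -> @admissible X (consolidate ge w)
}.

Arguments interp {L} p R.
Arguments admissible {L} p X.

Fixpoint sat (L : signature) (M : protoStructure L) (X : context)
    (phi : formula L X) : (X -> set M) -> Prop :=
  match phi in formula _ X return (X -> set M) -> Prop with
  | Bot X => fun _ => False
  | Atom X R x => fun v =>
      exists a : 'I_(arity R) -> M, (forall k, v (x k) (a k)) /\ interp M R a
  | Neg X phi => fun v => ~ sat phi v
  | Conj X phi psi => fun v => sat phi v /\ sat psi v
  | ExFr X Y ge _ phi => fun v =>
      exists w : Y -> set M,
        [/\ admissible M Y w, v = consolidate ge w & sat phi w]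
  end.

Definition directed (L : signature) (M : protoStructure L) : Prop :=
  forall (X Y : context) (v : X -> set M) (w : Y -> set M),
    admissible M X v -> admissible M Y w ->
    exists (Z : context) (u : Z -> set M),
      [/\ admissible M Z u, consolidation v u & consolidation w u].

Definition atoms_witnessed (L : signature) (M : protoStructure L) : Prop :=
  forall (X : context) (v : X -> set M) (R : symbol L) (x : 'I_(arity R) -> X),
    admissible M X v -> sat (Atom x) v ->
    exists (Y : context) (w : Y -> set M) (y : 'I_(arity R) -> Y)
           (a : 'I_(arity R) -> M),
      [/\ admissible M Y w,
          forall k, rel_pi w (y k) (a k),
          forall k, w (y k) `<=` v (x k)
        & interp M R a].

Record structure (L : signature) := Structure {
  proto :> protoStructure L;
  structure_directed : directed proto;
  structure_atoms : atoms_witnessed proto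
}.

Section Semantics.
Variable L : signature.
Implicit Types M N : structure L.

Definition tp M (X : context) (v : X -> set M) : set (formula L X) :=
  [set phi | sat phi v].

Definition realizes N (X : context) (p : set (formula L X)) : Prop :=
  exists2 w : X -> set N, admissible N X w & forall phi, p phi -> sat phi w.

(* There is at most one co-valuation in the context {star}, and it is
   admissible as soon as some co-valuation in a nonempty context is. *)
Definition holds M (phi : sentence L) : Prop :=
  exists2 v : star_context -> set M, admissible M star_context v & sat phi v.

Definition elementarily_equivalent M N : Prop :=
  forall phi : sentence L, holds M phi <-> holds N phi.

(* (M, V) is compact when some topology on the carrier satisfies the conditions
   below; each relation is closed in the product topology. *)
Definition open_cover (T : topologicalType) (C : set (set T)) : Prop :=
  (forall U, C U -> open U) /\ \bigcup_(U in C) U = [set: T].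

Definition refines (T : Type) (C D : set (set T)) : Prop :=
  forall U, C U -> exists2 O, D O & U `<=` O.

Definition compact_structure M : Prop :=
  exists tau : Topological.axioms_ M,
    let T : topologicalType := Topological.Pack tau in
    [/\ compact [set: T] /\ accessible_space T,
        forall (X : context) (v : X -> set M),
          admissible M X v -> @open_cover T (range v),
        forall C : set (set M), @open_cover T C ->
          exists (X : context) (v : X -> set M),
            admissible M X v /\ refines (range v) C
      & forall R : symbol L,
          @closed (prod_topology (fun _ : 'I_(arity R) => T)) (interp M R)].

Definition omega_structure M : Prop :=
  exists (X : nat -> context) (v : forall i, X i -> set M),
    [/\ forall i, admissible M (X i) (v i),
        forall i, consolidation (v i) (v i.+1)
      & forall (Y : context) (w : Y -> set M), admissible M Y w ->
          exists i, consolidation w (v i)].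

(* Contexts are preserved: an admissible co-valuation in context X consolidates
   itself with the identity pattern on X, so by the second condition its image
   must be a co-valuation in context X as well. *)
Definition elementary_embedding N M
    (f : forall X : context, (X -> set N) -> (X -> set M)) : Prop :=
  [/\ forall X w, admissible N X w -> admissible M X (f X w),
      forall X, set_inj (admissible N X) (f X),
      forall (X Y : context) (w : X -> set N) (w' : Y -> set N)
          (ge : X -> set Y),
        admissible N X w -> admissible N Y w' -> Val X Y ge ->
        (w = consolidate ge w' <-> f X w = consolidate ge (f Y w'))
    & forall (X : context) (w : X -> set N) (phi : formula L X),
        admissible N X w -> (sat phi w <-> sat phi (f X w))].

End Semantics.

(* Main.v *)
Require Import Defs.
From HB Require Import structures.
From mathcomp Require Import all_boot finmap.
From mathcomp Require Import boolp classical_sets functions cardinality.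
From mathcomp Require Import topology.
From Stdlib Require Import Eqdep_dec.
Set Implicit Arguments.
Unset Strict Implicit.
Unset Printing Implicit Defensive.
Local Open Scope classical_set_scope.

(* A Skolem hull argument, using that L has countably many formulas, yields a
   countable family A of admissible co-valuations that contains v0, is directed
   and closed under consolidations, and contains the witnesses demanded by
   fragmentation quantifiers and by condition (II).  The carrier of N is the
   spectrum of A: its points are the minimal selectors, that is, the minimal
   upward closed families of subsets of M meeting every cover of A, and w in A
   becomes the co-valuation hat w sending x to the set of points containing
   [x]_w.  Since co-valuations are minimal covers, every member of w has a
   private point a, and a minimal selector of sets containing a meets w only
   at that member.
   Consequently hat is injective and preserves and reflects consolidations.
   Relations are interpreted by the points all of whose product neighbourhoods
   meet the relation in M. *)

(** * Codes for patterns and formulas, and countable closure *)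

Lemma existT_context_inj (F : context -> Type) (X : context) (s t : F X) :
  existT F X s = existT F X t -> s = t.
Proof. by apply: inj_pair2_eq_dec; exact: eq_comparable. Qed.

(** The type of the code does not depend on [X] and [Y], so patterns between arbitrary contexts fit
    into one countable type. *)
Definition pattern_code (X Y : context) (ge : X -> set Y) : {fset nat * nat} :=
  [fset (val p.1, val p.2) | p in [pred p : X * Y | `[< ge p.1 p.2 >]]]%fset.

Lemma pattern_code_inj (X Y : context) : injective (@pattern_code X Y).
Proof.
have codeP (g : X -> set Y) x y : (val x, val y) \in pattern_code g <-> g x y.
  split=> [/imfsetP[[x' y'] /= gxy [/val_inj-> /val_inj->]]|gxy].
    exact/asboolP.
  by apply/imfsetP; exists (x, y) => //=; apply/asboolP.
move=> g h gh; apply/funext => x; apply/funext => y; apply/propext.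
by rewrite -codeP gh codeP.
Qed.

(** A choice function [g] for [P] generates from [t0] the values of finite Skolem terms. Terms are
    trees over the countable type [Q], hence enumerable. *)
Lemma skolem_hull (T : Type) (Q : countType) (P : Q -> T -> T -> T -> Prop)
    (t0 : T) :
  exists e : nat -> T, (exists k, e k = t0) /\
    forall q m n, (exists t, P q (e m) (e n) t) ->
      exists k, P q (e m) (e n) (e k).
Proof.
have /choice[g gP] (x : Q * T * T) :
    exists t, (exists t', P x.1.1 x.1.2 x.2 t') -> P x.1.1 x.1.2 x.2 t.
  have [[t Pt]|nP] := pselect (exists t, P x.1.1 x.1.2 x.2 t).
    by exists t.
  by exists t0.
(* A node with a leaf [q] and two subtrees applies [g]; every other tree denotes [t0]. *)
pose fix eval (t : GenTree.tree Q) : T :=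
  match t with
  | GenTree.Node _ [:: GenTree.Leaf q; a; b] => g (q, eval a, eval b)
  | _ => t0
  end.
exists (fun n : nat => oapp eval t0 (choice.unpickle n)); split.
  exists (choice.pickle (GenTree.Node 0 [::] : GenTree.tree Q)).
  by rewrite choice.pickleK.
move=> q m n; have surj k : exists t, oapp eval t0 (choice.unpickle k) = eval t.
  by case: (choice.unpickle k) => [t|]; [exists t|exists (GenTree.Node 0 [::])].
have [[ta ->] [tb ->] ex] := (surj m, surj n).
exists (choice.pickle (GenTree.Node 0 [:: GenTree.Leaf q; ta; tb])).
by rewrite choice.pickleK; exact: (gP (q, eval ta, eval tb)).
Qed.

Section FormulaCode.
Variables (L : signature) (s : symbol L -> nat).

Fixpoint formula_code (X : context) (phi : formula L X) : GenTree.tree nat :=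
  match phi with
  | Bot X => GenTree.Node 0 [:: GenTree.Leaf (choice.pickle X)]
  | Atom X R x => GenTree.Node 1
      [:: GenTree.Leaf (choice.pickle X); GenTree.Leaf (s R);
          GenTree.Leaf (choice.pickle (finfun x))]
  | Neg X phi => GenTree.Node 2 [:: formula_code phi]
  | Conj X phi psi => GenTree.Node 3 [:: formula_code phi; formula_code psi]
  | ExFr X Y ge _ phi => GenTree.Node 4
      [:: GenTree.Leaf (choice.pickle X); GenTree.Leaf (choice.pickle Y);
          GenTree.Leaf (choice.pickle [ffun p : X * Y => `[< ge p.1 p.2 >]]);
          formula_code phi]
  end.

Hypothesis s_inj : injective s.

Let pickle_inj (T : countType) : injective (@choice.pickle T) :=
  pcan_inj choice.pickleK.

(** The equality is between dependent pairs because the contexts agree only as a consequence: the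
    code determines them, through the subformulas for [Neg] and [Conj]. The proof that [ge] is a
    pattern is not coded; proof irrelevance recovers it. *)
Lemma formula_code_inj (X X' : context) (phi : formula L X)
    (psi : formula L X') :
  formula_code phi = formula_code psi ->
  existT (formula L) X phi = existT (formula L) X' psi.
Proof.
elim: phi X' psi => {X}
  [X|X R x|X phi IH|X phi1 IH1 phi2 IH2|X Y ge pge phi IH] X'
  [{}X'|{}X' R' x'|{}X' psi|{}X' psi1 psi2|{}X' Y' ge' pge' psi] //=.
- by case=> /pickle_inj ->.
- case=> /pickle_inj eX /s_inj eR; subst X' R' => /pickle_inj ex.
  suff -> : x = x' by [].
  by apply/funext => k; have /ffunP/(_ k) := ex; rewrite !ffunE.
- case=> /IH e; have eX : X = X' by exact: (congr1 (@projT1 _ _) e).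
  by subst X'; rewrite (existT_context_inj e).
- case=> /IH1 e1 /IH2.
  have eX : X = X' by exact: (congr1 (@projT1 _ _) e1).
  subst X' => e2.
  by rewrite (existT_context_inj e1) (existT_context_inj e2).
- case=> /pickle_inj eX /pickle_inj eY; subst X' Y' => /pickle_inj ege.
  move=> /IH e; rewrite (existT_context_inj e).
  have eg : ge = ge'.
    apply/funext => x; apply/funext => y; apply/propext.
    have /ffunP/(_ (x, y)) := ege; rewrite !ffunE /= => egE.
    by split=> /asboolP; [rewrite egE|rewrite -egE] => /asboolP.
  by subst ge'; rewrite (Prop_irrelevance pge pge').
Qed.

End FormulaCode.

(** * Countable elementary families of co-valuations *)

Record elementary_family (L : signature) (M : structure L) := ElementaryFamily {
  member :> forall X : context, set (X -> set M);
  member_inhabited : exists (X : context) (w : X -> set M), @member X w;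
  member_admissible : forall X, @member X `<=` @admissible L M X;
  member_consolidate :
    forall (X Y : context) (ge : X -> set Y) (w : Y -> set M),
      Val X Y ge -> @member Y w -> @member X (consolidate ge w);
  member_directed :
    forall (X Y : context) (v : X -> set M) (w : Y -> set M),
      @member X v -> @member Y w ->
      exists (Z : context) (u : Z -> set M),
        [/\ @member Z u, consolidation v u & consolidation w u];
  member_exfr :
    forall (X Y : context) (ge : X -> set Y) (pge : Val X Y ge)
        (phi : formula L Y) (v : X -> set M),
      @member X v -> sat (ExFr pge phi) v ->
      exists w : Y -> set M, [/\ @member Y w, v = consolidate ge w & sat phi w];
  member_atoms :
    forall (X : context) (v : X -> set M) (R : symbol L)
        (x : 'I_(arity R) -> X),
      @member X v -> sat (Atom x) v ->
      exists (Y : context) (w : Y -> set M) (y : 'I_(arity R) -> Y)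
             (a : 'I_(arity R) -> M),
        [/\ @member Y w,
            forall k, rel_pi w (y k) (a k),
            forall k, w (y k) `<=` v (x k)
          & interp M R a]
}.

Arguments member {L M} A X w : rename.

Section DownwardLoewenheimSkolem.
Variables (L : signature) (M : structure L).

Let cov := {X : context & X -> set M}.

(** The Skolem condition of a formula: condition (II) for atoms, a fragmentation for [ExFr]. Other
    formulas ask for nothing. *)
Definition formula_witness (X : context) (phi : formula L X) :
    (X -> set M) -> cov -> Prop :=
  match phi with
  | Atom X R x => fun v t =>
      exists (y : 'I_(arity R) -> projT1 t) (a : 'I_(arity R) -> M),
        [/\ forall k, rel_pi (projT2 t) (y k) (a k),
            forall k, projT2 t (y k) `<=` v (x k)
          & interp M R a]
  | ExFr X Y ge _ phi => fun v t =>
      exists w : Y -> set M,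
        [/\ t = existT _ Y w, v = consolidate ge w & sat phi w]
  | _ => fun _ _ => False
  end.

Lemma countable_elementary_family (X0 : context) (v0 : X0 -> set M) :
  countable [set: symbol L] -> admissible M X0 v0 ->
  exists A : elementary_family M, A X0 v0 /\
    exists e : nat -> cov, forall X w, A X w -> exists k, e k = existT _ X w.
Proof.
move=> /countable_injP[s] s_inj v0adm.
have {}s_inj : injective s by move=> a b; apply: s_inj; rewrite inE.
(* The request [q] asks for a common fragmentation of [a] and [b], for the consolidation of [a] by a
   coded pattern, or for a witness of a coded formula at [a]; the last two ignore [b]. *)
pose P (q : unit + (context * {fset nat * nat}) + GenTree.tree nat)
    (a b t : cov) : Prop :=
  admissible M _ (projT2 t) /\
  match q with
  | inl (inl _) =>
      consolidation (projT2 a) (projT2 t) /\ consolidation (projT2 b) (projT2 t)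
  | inl (inr (X, p)) =>
      exists ge : X -> set (projT1 a),
        [/\ Val X (projT1 a) ge, p = pattern_code ge
          & t = existT _ X (consolidate ge (projT2 a))]
  | inr c => exists phi : formula L (projT1 a),
      formula_code s phi = c /\ formula_witness phi (projT2 a) t
  end.
have [e [[k0 ek0] eP]] := skolem_hull P (existT _ X0 v0).
pose A (X : context) : set (X -> set M) :=
  [set w | admissible M X w /\ exists k, e k = existT _ X w].
have Acl q (X Y : context) (v : X -> set M) (w : Y -> set M) : A X v -> A Y w ->
    (exists t, P q (existT _ X v) (existT _ Y w) t) ->
    exists t, A (projT1 t) (projT2 t) /\ P q (existT _ X v) (existT _ Y w) t.
  move=> [_ [m <-]] [_ [n <-]] /eP[k [adm Pk]]; exists (e k).
  by split=> //; split=> //; exists k; case: (e k).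
have Aadm (X : context) : A X `<=` @admissible L M X by move=> w [].
have Acons (X Y : context) (ge : X -> set Y) (w : Y -> set M) :
    Val X Y ge -> A Y w -> A X (consolidate ge w).
  move=> pge Aw.
  have [|t [At [_ [ge' [_ /pattern_code_inj-> tE]]]]] :=
      Acl (inl (inr (X, pattern_code ge))) _ _ _ _ Aw Aw.
    exists (existT _ X (consolidate ge w)); split => /=.
      by apply: admissible_consolidate => //; exact: Aadm.
    by exists ge.
  by move: At; rewrite tE.
have Adir (X Y : context) (v : X -> set M) (w : Y -> set M) :
      A X v -> A Y w ->
      exists (Z : context) (u : Z -> set M),
        [/\ A Z u, consolidation v u & consolidation w u].
  move=> Av Aw.
  have [|t [At [_ [/= vt wt]]]] := Acl (inl (inl tt)) _ _ _ _ Av Aw.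
    have [Z [u [? ? ?]]] := structure_directed (Aadm _ _ Av) (Aadm _ _ Aw).
    by exists (existT _ Z u).
  by exists (projT1 t), (projT2 t).
have Aex (X Y : context) (ge : X -> set Y) (pge : Val X Y ge)
      (phi : formula L Y) (v : X -> set M) :
    A X v -> sat (ExFr pge phi) v ->
    exists w : Y -> set M, [/\ A Y w, v = consolidate ge w & sat phi w].
  move=> Av [w [wadm vE wphi]].
  have [|t [At [_ [/= psi [ce]]]]] :=
      Acl (inr (formula_code s (ExFr pge phi))) _ _ _ _ Av Av.
    exists (existT _ Y w); split => //=.
    by exists (ExFr pge phi); split=> //; exists w.
  rewrite (existT_context_inj
    (formula_code_inj (psi := ExFr pge phi) s_inj ce)).
  by move=> [w' [tE -> phiw']]; exists w'; split=> //; rewrite tE in At.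
have Aat (X : context) (v : X -> set M) (R : symbol L)
        (x : 'I_(arity R) -> X) :
      A X v -> sat (Atom x) v ->
      exists (Y : context) (w : Y -> set M) (y : 'I_(arity R) -> Y)
             (a : 'I_(arity R) -> M),
        [/\ A Y w,
            forall k, rel_pi w (y k) (a k),
            forall k, w (y k) `<=` v (x k)
          & interp M R a].
  move=> Av satv.
  have [|t [At [_ [/= psi [ce]]]]] :=
      Acl (inr (formula_code s (Atom x))) _ _ _ _ Av Av.
    have [Y [w [y [a [wadm ya yx Ra]]]]] := structure_atoms (Aadm _ _ Av) satv.
    exists (existT _ Y w); split => //=.
    by exists (Atom x); split=> //; exists y, a.
  rewrite (existT_context_inj (formula_code_inj (psi := Atom x) s_inj ce)).
  by move=> [y [a [ya yx Ra]]]; exists (projT1 t), (projT2 t), y, a.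
have Ainh : exists (X : context) (w : X -> set M), A X w.
  by exists X0, v0; split=> //; exists k0.
exists (ElementaryFamily Ainh Aadm Acons Adir Aex Aat); split.
  by split=> //; exists k0.
by exists e => X w [].
Qed.

End DownwardLoewenheimSkolem.

(** * Consolidations and private points *)

Lemma consolidation_below (X Y : context) (M : Type) (v : X -> set M)
    (w : Y -> set M) (y : Y) :
  consolidation v w -> exists x, w y `<=` v x.
Proof.
by move=> [ge [_ /(_ y)[x gexy]] ->]; exists x => a wya; exists y.
Qed.

(** Since [a] is private to [w y], it can enter [v x] only through the index [y], which brings all
    of [w y] along. *)
Lemma consolidation_prime (X Y : context) (M : Type) (v : X -> set M)
    (w : Y -> set M) (x : X) (y : Y) (a : M) :
  consolidation v w -> rel_pi w y a -> v x a -> w y `<=` v x.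
Proof.
move=> [ge _ ->] [_ ypriv] [y' [gexy' /ypriv y'E]] b wyb.
by exists y; rewrite -{1}y'E.
Qed.

(** * Selectors and their minimal elements *)

Section Spectrum.
Variables (L : signature) (M : structure L) (A : elementary_family M).
Implicit Types (S T : set (set M)) (U V : set M).

Lemma member_Val (X : context) (w : X -> set M) : A X w -> Val X M w.
Proof. by move=> /member_admissible/admissible_Val. Qed.

Definition selector S : Prop :=
  (forall U V, U `<=` V -> S U -> S V) /\
  forall (X : context) (w : X -> set M), A X w -> exists x, S (w x).

Definition minimal_selector S : Prop :=
  selector S /\ forall T, selector T -> T `<=` S -> S `<=` T.

Lemma selector_at (a : M) : selector [set U | U a].
Proof.
split=> [U V UV|X w /member_Val[_ /(_ a)//]]; exact: UV.
Qed.

(** Zorn's lemma is applied to the families [F] removed from [T], so that chains are bounded by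
    unions. Finiteness of contexts keeps the limit a selector. *)
Lemma selector_minimal T :
  selector T -> exists2 S, minimal_selector S & S `<=` T.
Proof.
move=> selT; have [F [selF Fmax]] :
    exists F, selector (T `\` F) /\ forall B, F `<` B -> ~ selector (T `\` B).
  apply: Zorn_bigcup => C CP Ctot; split=> [U V UV [TU nU]|X w Aw].
    split; first exact: selT.1 TU.
    move=> [F CF FV]; apply: nU; exists F => //; apply: contrapT => nFU.
    by have [_] := (CP F CF).1 _ _ UV (conj TU nFU).
  apply: contrapT => /forallNP nw.
  (* The members of [w] in [T] are finitely many, so a single [F] of the chain removes them all;
     [set0] starts the induction and covers the empty chain. *)
  have [F [CF Fw]] : exists F, (C F \/ F = set0) /\
      forall x, x \in enum {: X} -> T (w x) -> F (w x).
    elim: (enum {: X}) => [|x s [F [CF Fs]]].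
      by exists set0; split; [right|].
    have [Tx|nTx] := pselect (T (w x)); last first.
      exists F; split=> // x'; rewrite inE => /orP[/eqP->//|]; exact: Fs.
    have [G CG Gx] : (\bigcup_(G in C) G) (w x).
      by apply: contrapT => nx; apply: (nw x).
    have [FG|GF] : F `<=` G \/ G `<=` F.
      case: CF => [CF|->]; first exact: Ctot.
      by left.
    - exists G; split=> [|x']; first by left.
      by rewrite inE => /orP[/eqP->//|x's /(Fs _ x's)/FG].
    - exists F; split=> // x'; rewrite inE => /orP[/eqP-> _|]; first exact: GF.
      exact: Fs.
  have [x [Tx]] : exists x, (T `\` F) (w x).
    case: CF => [/CP[_]|->]; first exact.
    by rewrite setD0; exact: selT.2.
  by apply; apply: Fw => //; rewrite mem_enum.
exists (T `\` F); last by move=> U [].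
split=> // S selS SF U [TU nFU]; apply: contrapT => nSU.
(* Removing everything outside [S] leaves [S] itself, and removes strictly more than [F] because [U]
   is lost. *)
apply: (Fmax (~` S)).
  split=> [V FV SV|]; first by have [_] := SF _ SV.
  by move=> /(_ U nSU).
suff -> : T `\` ~` S = S by [].
apply/seteqP; split=> [V [_ /contrapT]//|V SV].
by split; [have [] := SF _ SV|move=> nSV; exact: nSV].
Qed.

(** Otherwise deleting all subsets of [U] from [S] would leave a selector, against minimality. *)
Lemma minimal_selector_fine S U : minimal_selector S -> S U ->
  exists (X : context) (w : X -> set M),
    A X w /\ forall x, S (w x) -> w x `<=` U.
Proof.
move=> [selS minS] SU; apply: contrapT => nex.
suff selS' : selector [set V | S V /\ ~ V `<=` U].
  have sub : [set V | S V /\ ~ V `<=` U] `<=` S by move=> V [].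
  by have [_] := minS _ selS' sub _ SU; apply.
split=> [V V' VV' [SV nVU]|X w Aw].
  split; first exact: selS.1 SV.
  by move=> V'U; apply: nVU; exact: subset_trans V'U.
apply: contrapT => /forallNP nx; apply: nex; exists X, w; split=> // x Sx.
by apply: contrapT => nxU; exact: (nx x).
Qed.

Lemma minimal_selector_directed S U V : minimal_selector S -> S U -> S V ->
  exists (X : context) (w : X -> set M) (x : X),
    [/\ A X w, S (w x), w x `<=` U & w x `<=` V].
Proof.
move=> Smin SU SV; have [[up cov] _] := Smin.
have [X1 [w1 [Aw1 w1U]]] := minimal_selector_fine Smin SU.
have [X2 [w2 [Aw2 w2V]]] := minimal_selector_fine Smin SV.
have [Z [u [Au w1u w2u]]] := member_directed Aw1 Aw2.
have [z Sz] := cov _ _ Au; exists Z, u, z; split=> //.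
- have [x zx] := consolidation_below z w1u.
  exact: subset_trans (w1U x (up _ _ zx Sz)).
- have [x zx] := consolidation_below z w2u.
  exact: subset_trans (w2V x (up _ _ zx Sz)).
Qed.

(** * Points of the spectrum and the co-valuations on them *)

Definition point : Type := {S | minimal_selector S}.

Implicit Types p q : point.

Definition trace U : set point := [set p | sval p U].

Definition hat (X : context) (w : X -> set M) : X -> set point :=
  fun x => trace (w x).

Lemma trace_mono U V : U `<=` V -> trace U `<=` trace V.
Proof. by move=> UV [S [[up _] _]] /=; exact: up. Qed.

Lemma point_ext p q : sval p = sval q -> p = q.
Proof. by case: p q => [S Smin] [T Tmin] /= ST; exact: eq_exist. Qed.

(** A minimal selector below the family of all sets containing [a] inherits the privacy of [a]. *)
Lemma hat_pi (X : context) (w : X -> set M) (x : X) (a : M) :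
  A X w -> rel_pi w x a ->
  exists2 p, rel_pi (hat w) x p & forall U, sval p U -> U a.
Proof.
move=> Aw [wxa xpriv]; have [S Smin Sa] := selector_minimal (selector_at a).
have priv x' : S (w x') -> x' = x by move=> /Sa/xpriv.
exists (exist _ S Smin) => //; split=> //; rewrite /hat /trace /=.
by have [[_ cov] _] := Smin; have [x' Sx'] := cov _ _ Aw; rewrite -(priv x').
Qed.

Lemma hat_Val (X : context) (w : X -> set M) : A X w -> Val X point (hat w).
Proof.
move=> Aw; split=> [x|[S Smin]]; last first.
  by have [x Sx] := Smin.1.2 _ _ Aw; exists x.
have [/(_ x)[a xa] _] := member_Val Aw.
by have [p px _] := hat_pi Aw xa; exists p.
Qed.

(** The converse of monotonicity must place a point containing a union of members of [w] in one of
    them. A fine enough [u] fragmenting [w] has a member in the point and inside the union; its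
    private point selects the member of [w]. *)
Lemma hat_consolidate (X Y : context) (ge : X -> set Y) (w : Y -> set M) :
  Val X Y ge -> A Y w -> hat (consolidate ge w) = consolidate ge (hat w).
Proof.
move=> pge Aw; apply/funext => x; apply/seteqP; split=> p; last first.
  by move=> [y [xy]]; apply: trace_mono => a wya; exists y.
case: p => S Smin; rewrite /hat /trace /= => Sx.
have [X1 [w1 [Aw1 w1x]]] := minimal_selector_fine Smin Sx.
have [Z [u [Au wu w1u]]] := member_directed Aw Aw1.
have [[up cov] _] := Smin; have [z Sz] := cov _ _ Au.
have [/(_ z)[a za] _] := member_Val Au.
have [x1 zx1] := consolidation_below z w1u.
have [y [xy wya]] : consolidate ge w x a.
  by apply: (w1x x1 (up _ _ zx1 Sz)); apply: zx1; case: za.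
exists y; split=> //=; apply: up Sz; exact: consolidation_prime za wya.
Qed.

Lemma consolidation_hat (X Y : context) (v : X -> set M) (w : Y -> set M) :
  A Y w -> consolidation v w -> consolidation (hat v) (hat w).
Proof. by move=> Aw [ge pge ->]; exists ge; rewrite ?hat_consolidate. Qed.

(** It suffices to treat the members [u z] of a common fragmentation. A point below a private [a] of
    [u z] lies in [hat v x], so [a] is in [w y], and primality gives the inclusion. *)
Lemma hat_reflects_subset (X Y : context) (v : X -> set M) (w : Y -> set M)
    (x : X) (y : Y) :
  A X v -> A Y w -> hat v x `<=` hat w y -> v x `<=` w y.
Proof.
move=> Av Aw xy b; have [Z [u [Au [ge pge vE] wu]]] := member_directed Av Aw.
rewrite vE => -[z [xz uzb]]; have [/(_ z)[a za] _] := member_Val Au.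
have [p [pz _] pa] := hat_pi Au za.
have /xy/pa wya : hat v x p.
  by apply: trace_mono pz => c uzc; rewrite vE; exists z.
exact: consolidation_prime wu za wya _ uzb.
Qed.

Lemma hat_inj (X : context) (v w : X -> set M) :
  A X v -> A X w -> hat v = hat w -> v = w.
Proof.
move=> Av Aw vw; apply/funext => x.
by apply/seteqP; split; apply: hat_reflects_subset => //; rewrite vw.
Qed.

(** * The structure on the spectrum *)

Definition spectrum_interp (R : symbol L) : set ('I_(arity R) -> point) :=
  [set p | forall U : 'I_(arity R) -> set M, (forall k, sval (p k) (U k)) ->
     exists2 a, (forall k, U k (a k)) & interp M R a].

Definition spectrum_admissible (X : context) : set (X -> set point) :=
  [set hat w | w in A X].

Lemma spectrum_admissible_Val (X : context) :
  @spectrum_admissible X `<=` Val X point.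
Proof. by move=> _ [w Aw <-]; exact: hat_Val. Qed.

Lemma spectrum_admissible_consolidate (X Y : context) (ge : X -> set Y)
    (w : Y -> set point) :
  Val X Y ge -> spectrum_admissible w ->
  spectrum_admissible (consolidate ge w).
Proof.
move=> pge [v Av <-]; exists (consolidate ge v).
  exact: member_consolidate.
by rewrite hat_consolidate.
Qed.

Definition spectrum_proto : protoStructure L :=
  ProtoStructure spectrum_interp spectrum_admissible_Val
    spectrum_admissible_consolidate.

(* The point chosen below a_k contains only sets containing a_k, so that the
   relation holds between such points as soon as it holds between the a_k. *)
Lemma spectrum_interp_witness (X : context) (w : X -> set M) (R : symbol L)
    (x : 'I_(arity R) -> X) (a : 'I_(arity R) -> M) :
  A X w -> (forall k, rel_pi w (x k) (a k)) -> interp M R a ->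
  exists2 p, forall k, rel_pi (hat w) (x k) (p k) & spectrum_interp p.
Proof.
move=> Aw xa Ra.
have /choice[p pP] k : exists p, rel_pi (hat w) (x k) p /\
    forall U, sval p U -> U (a k).
  by have [p] := hat_pi Aw (xa k); exists p.
exists p => [k|U pU]; first by have [] := pP k.
by exists a => // k; apply: (pP k).2.
Qed.

(** Induction on formulas. An atom descends by testing [spectrum_interp] on the sets [w (x k)] and
    ascends by [member_atoms]; for [ExFr], [member_exfr] acts as the Tarski-Vaught test. *)
Lemma sat_hat (X : context) (phi : formula L X) (w : X -> set M) :
  A X w -> (@sat L spectrum_proto X phi (hat w) <-> sat phi w).
Proof.
elim: phi w => {X} [X|X R x|X phi IH|X phi IH1 psi IH2|X Y ge pge phi IH] w Aw.
- by [].
- split=> [[p [px /(_ _ px)[a wa Ra]]]|]; first by exists a.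
  move=> /(member_atoms Aw)[Y [u [y [a [Au ya yx Ra]]]]].
  have [p py Rp] := spectrum_interp_witness Au ya Ra.
  by exists p; split=> // k; apply: (trace_mono (yx k)); have [] := py k.
- by rewrite /= IH.
- by rewrite /= IH1 // IH2.
- split=> [[_ [[u Au <-] wE phiu]]|].
    exists u; split; [exact: (member_admissible Au)| |exact/(IH _ Au)].
    apply: hat_inj => //; first exact: member_consolidate.
    by rewrite wE hat_consolidate.
  move=> /(member_exfr Aw)[u [Au wE phiu]]; exists (hat u); split.
  + by exists u.
  + by rewrite wE hat_consolidate.
  + exact/(IH _ Au).
Qed.

Lemma spectrum_directed : directed spectrum_proto.
Proof.
move=> X Y _ _ [v Av <-] [w Aw <-].
have [Z [u [Au vu wu]]] := member_directed Av Aw.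
by exists Z, (hat u); split; [exists u|exact: consolidation_hat..].
Qed.

Lemma spectrum_atoms_witnessed : atoms_witnessed spectrum_proto.
Proof.
move=> X _ R x [v Av <-] /(sat_hat (Atom x) Av).
move=> /(member_atoms Av)[Y [w [y [a [Aw ya yx Ra]]]]].
have [p py Rp] := spectrum_interp_witness Aw ya Ra.
exists Y, (hat w), y, p; split=> //; first by exists w.
by move=> k; exact: trace_mono.
Qed.

Definition spectrum : structure L :=
  Structure spectrum_directed spectrum_atoms_witnessed.

(** * The compact T1 topology generated by traces *)

Definition spectrum_open (O : set point) : Prop :=
  forall p, O p -> exists2 U, sval p U & trace U `<=` O.

Lemma spectrum_openT : spectrum_open setT.
Proof.
move=> [S Smin] _; have [X [w Aw]] := member_inhabited A.
by have [x Sx] := Smin.1.2 _ _ Aw; exists (w x).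
Qed.

Lemma spectrum_openI : setI_closed spectrum_open.
Proof.
move=> O1 O2 op1 op2 p [/op1[U pU UO] /op2[V pV VO]].
have [X [w [x [_ px xU xV]]]] := minimal_selector_directed (svalP p) pU pV.
exists (w x) => // q qx; split; [apply: UO|apply: VO]; exact: trace_mono qx.
Qed.

Lemma spectrum_open_bigcup (I : Type) (f : I -> set point) :
  (forall i, spectrum_open (f i)) -> spectrum_open (\bigcup_i f i).
Proof.
move=> op p [i _ /op[U pU UO]]; exists U => // q /UO; by exists i.
Qed.

HB.instance Definition _ := gen_eqMixin point.
HB.instance Definition _ := gen_choiceMixin point.
HB.instance Definition _ := isOpenTopological.Build point
  spectrum_openT spectrum_openI spectrum_open_bigcup.

Lemma trace_open U : open (trace U).
Proof. by move=> p pU; exists U. Qed.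

(** If no cover refined [C], the sets whose trace lies in no member of [C] would form a selector; a
    minimal selector below it would be a point outside the union of [C]. *)
Lemma open_cover_refined (C : set (set point)) : open_cover C ->
  exists (X : context) (w : X -> set M), A X w /\ refines (range (hat w)) C.
Proof.
move=> [Cop Ccov]; apply: contrapT => nex.
have [|S Smin ST] :=
    @selector_minimal [set V | forall O, C O -> ~ trace V `<=` O].
  split=> [U V UV nU O CO VO|X w Aw].
    by apply: (nU _ CO); apply: subset_trans VO; exact: trace_mono.
  apply: contrapT => /forallNP nx; apply: nex; exists X, w.
  split=> // _ [x _ <-].
  have /existsNP[O /not_implyP[CO /contrapT xO]] := nx x; by exists O.
have [O CO pO] : (\bigcup_(U in C) U) (exist _ S Smin) by rewrite Ccov.
have [U pU UO] := Cop _ CO _ pO.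
exact: ST _ pU _ CO UO.
Qed.

(** Without a cluster point, the open sets with complement in [F] cover the space. A refining
    [hat w] has finitely many members, so [F] contains the complement of their union, which is
    empty. *)
Lemma spectrum_compact_space : compact [set: point].
Proof.
move=> F FF _; apply: contrapT => ncl.
have [|X [w [Aw wC]]] := @open_cover_refined [set O | open O /\ F (~` O)].
  split=> [O []//|]; apply/seteqP; split=> // p _; apply: contrapT => npC.
  apply: ncl; exists p; split=> // B N FB; rewrite nbhsE => -[O [Oop Op] ON].
  apply: contrapT => nBN; apply: npC; exists O => //; split=> //.
  by apply: filterS FB => q Bq Oq; apply: nBN; exists q; split=> //; exact: ON.
have Fw : \forall q \near F, forall x, ~ hat w x q.
  apply: filter_forall => x; have [O [_ FO] xO] := wC _ (imageT (hat w) x).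
  by apply: filterS FO => q nOq /xO.
by have [q nq] := filter_ex Fw; have [x] := (hat_Val Aw).2 q; exact: nq.
Qed.

(** Distinct minimal selectors are incomparable. *)
Lemma spectrum_accessible : accessible_space point.
Proof.
move=> p q pq; have [U [pU nqU]] : exists U, sval p U /\ ~ sval q U.
  apply: contrapT => /forallNP npq; have sub : sval p `<=` sval q.
    by move=> U pU; apply: contrapT => nqU; apply: (npq U).
  move/eqP : pq; apply; apply/point_ext/seteqP; split=> //.
  by apply: (svalP q).2 => //; exact: (svalP p).1.
exists (trace U); split; [exact: trace_open|exact: mem_set|exact: mem_set].
Qed.

(** A family [U] refuting membership of [p] refutes it on the whole product of the [trace (U k)], a
    neighbourhood of [p] because the arity is finite. *)
Lemma spectrum_interp_closed (R : symbol L) :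
  @closed (prod_topology (fun _ : 'I_(arity R) => point)) (@spectrum_interp R).
Proof.
rewrite -openC openE => p /= /existsNP[U /not_implyP[pU nR]].
pose T : topologicalType := prod_topology (fun _ : 'I_(arity R) => point).
have FF : Filter (nbhs (p : T)) by exact: nbhs_filter.
have : nbhs (p : T) [set q | forall k, sval (q k) (U k)].
  apply: (filter_forall FF) => k.
  have cts :=
    @proj_continuous _ (fun _ : 'I_(arity R) => point : topologicalType) k p.
  apply: (cts (trace (U k))).
  by apply: open_nbhs_nbhs; split; [exact: trace_open|exact: pU].
by apply: filterS => q qU /(_ _ qU).
Qed.

Lemma spectrum_compact : compact_structure spectrum.
Proof.
exists (Topological.class point); split=> /=.
- by split; [exact: spectrum_compact_space|exact: spectrum_accessible].
- move=> X _ [w Aw <-]; split=> [_ [x _ <-]|]; first exact: trace_open.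
  apply/seteqP; split=> // p _; have [x px] := (hat_Val Aw).2 p.
  by exists (hat w x).
- move=> C /open_cover_refined[X [w [Aw wC]]].
  by exists X, (hat w); split=> //; exists w.
- exact: spectrum_interp_closed.
Qed.

(** * The cofinal sequence and the embedding *)

Lemma spectrum_omega (e : nat -> {X : context & X -> set M}) :
  (forall (X : context) (w : X -> set M),
     A X w -> exists k, e k = existT _ X w) ->
  omega_structure spectrum.
Proof.
move=> eP; pose cov := {X : context & X -> set M}.
pose B (t : cov) := A (projT1 t) (projT2 t).
have [X0 [w0 Aw0]] := member_inhabited A.
have /choice[h hP] (st : cov * cov) : exists u : cov, B st.1 -> B st.2 ->
    [/\ B u, consolidation (projT2 st.1) (projT2 u)
      & consolidation (projT2 st.2) (projT2 u)].
  have [[B1 B2]|nB] := pselect (B st.1 /\ B st.2); last first.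
    by exists st.1 => B1 B2; case: nB.
  have [Z [u ?]] := member_directed B1 B2; by exists (existT _ Z u).
(* The enumeration exhausts [A] but may leave it; such values are replaced by [w0]. *)
pose e' n := if pselect (B (e n)) then e n else existT _ X0 w0.
have Be' n : B (e' n) by rewrite /e'; case: pselect.
(* Each stage fragments the previous one and the next enumerated member, so [e' k] is a
   consolidation of [z k.+1]. *)
pose fix z n : cov := if n is n'.+1 then h (z n', e' n') else e' 0.
have Bz n : B (z n).
  by elim: n => [|n IH] //=; have [] := hP (z n, e' n) IH (Be' n).
have zS n := hP (z n, e' n) (Bz n) (Be' n).
exists (fun i => projT1 (z i)), (fun i => hat (projT2 (z i))); split.
- by move=> i; exists (projT2 (z i)) => //; exact: Bz.
- by move=> i; apply: consolidation_hat; [exact: Bz|case: (zS i)].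
- move=> Y _ [w Aw <-]; have [k ek] := eP _ _ Aw; exists k.+1.
  apply: consolidation_hat; first exact: Bz.
  have [_ _] := zS k; rewrite /= /e'; case: pselect => /=; rewrite ek //.
Qed.

(** The embedding goes from the spectrum back to [M], so it inverts [hat]; off the image of [hat]
    the value is an arbitrary default. *)
Definition unhat (X : context) (v : X -> set point) : X -> set M :=
  if pselect (exists w, A X w /\ hat w = v) is left ex
  then projT1 (cid ex) else fun=> set0.

Lemma hatK (X : context) (w : X -> set M) : A X w -> unhat (hat w) = w.
Proof.
move=> Aw; rewrite /unhat; case: pselect => [ex|[]]; last by exists w.
by case: (cid ex) => v [Av /= /hat_inj]; apply.
Qed.

Lemma unhat_embedding : @elementary_embedding L spectrum M unhat.
Proof.
split.
- by move=> X _ [w Aw <-]; rewrite hatK //; exact: member_admissible Aw.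
- move=> X _ _ /set_mem[v Av <-] /set_mem[w Aw <-].
  by rewrite !hatK // => ->.
- move=> X Y _ _ ge [v Av <-] [w Aw <-] pge; rewrite !hatK //.
  rewrite -hat_consolidate //; split=> [|->//].
  by apply: hat_inj => //; exact: member_consolidate.
- by move=> X _ phi [w Aw <-]; rewrite hatK //; exact: sat_hat.
Qed.

(** * Sentences and elementary equivalence *)

Lemma star_cover (P : Type) (v : star_context -> set P) :
  rel_cosurjective v -> v = fun=> setT.
Proof.
move=> cov; apply/funext => x; apply/seteqP; split=> // a _.
have [y] := cov a; suff -> : y = x by [].
by apply/val_inj; have /fset1P-> := valP x; have /fset1P-> := valP y.
Qed.

(** Sentences are evaluated at the only co-valuation in [star_context]; it belongs to [A] as the
    consolidation of any member by the full pattern. *)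
Lemma member_star (v : star_context -> set M) :
  admissible M star_context v -> A star_context v.
Proof.
move=> /admissible_Val[vinj vcov]; have [X [w Aw]] := member_inhabited A.
have star_in : (star \in star_context)%fset by rewrite inE.
(* The full pattern needs a nonempty [X]: a point [a] of [M] exists by co-injectivity of [v], and
   some member of [w] covers it. *)
have [a _] := vinj (FSetSub star_in).
have [x _] := (member_Val Aw).2 a.
have pge : Val star_context X (fun=> setT).
  split=> [s|y]; last by exists (FSetSub star_in).
  exists x; split=> // s' _.
  by apply/val_inj; have /fset1P-> := valP s; have /fset1P-> := valP s'.
have Ac := member_consolidate pge Aw.
by rewrite (star_cover vcov) -(star_cover (member_Val Ac).2).
Qed.

Lemma spectrum_equivalent : elementarily_equivalent M spectrum.
Proof.
move=> phi; split=> [[v /member_star Av satv]|[_ [w Aw <-]]].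
  by exists (hat v); [exists v|exact/sat_hat].
by move=> /sat_hat satw; exists w; [exact: (member_admissible Aw)|exact: satw].
Qed.

End Spectrum.

Theorem mainTheorem3 (L : signature) (M : structure L)
    (L_countable : countable [set: symbol L]) :
  (forall (X : context) (v0 : X -> set M), admissible M X v0 ->
     exists N : structure L,
       [/\ compact_structure N,
           omega_structure N,
           exists f : forall Y : context, (Y -> set N) -> (Y -> set M),
             elementary_embedding f /\
             exists2 w0 : X -> set N, admissible N X w0 & f X w0 = v0
         & elementarily_equivalent M N]) /\
  (forall (X : context) (v0 : X -> set M), admissible M X v0 ->
     exists N : structure L,
       [/\ compact_structure N, omega_structure N & realizes N (tp v0)]).
Proof.
split=> X v0 /(countable_elementary_family L_countable)[A [Av0 [e eP]]];
  exists (spectrum A); split; try exact: spectrum_compact;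
  try exact: spectrum_omega eP.
- exists (@unhat _ _ A); split; first exact: unhat_embedding.
  by exists (@hat _ _ A _ v0); [exists v0|exact: hatK].
- exact: spectrum_equivalent.
- by exists (@hat _ _ A _ v0) => [|phi]; [exists v0|exact: (sat_hat phi Av0).2].
Qed.
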